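(* Let $Ax-zx=y$, where $A\in BL(X)$, $x,y\in X$ and $z\notin\sigma(A)$. Further let $\delta x$ be the perturbation of the solution $x$ corresponding to the perturbations $\Delta A$, $\delta y$ of $A$, $y$ respectively, i.e. $(A-zI+\Delta A)(x+\delta x)=y+\delta y$. Then $$\frac{\|\delta x\|}{\|x\|}\le \frac{1}{\kappa(z,A)\,[1-\|(A-zI)^{-1}\Delta A\|]}\left(\frac{\|\delta y\|}{\|y\|}+\frac{\|\Delta A\|}{\|A-zI\|}\right),$$ where $\kappa(z,A):=\sup\{0<\epsilon<1: z\notin\sigma_\epsilon(A)\}$.
   Context: $X$ is a complex Banach space and $BL(X)$ is the Banach algebra of all bounded linear operators on $X$, with identity $I$. The spectrum of $A\in BL(X)$ is $\sigma(A)=\{z\in\mathbb{C}: A-zI \text{ is not invertible}\}$. For $0<\epsilon<1$ the $\epsilon$-condition pseudospectrum of $A$ is $$\sigma_\epsilon(A)=\sigma(A)\cup\{z\in\mathbb{C}: \|A-zI\|\,\|(A-zI)^{-1}\|\ge \epsilon^{-1}\}.$$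
   Formalization: The hypothesis ‖(A−zI)^{-1}ΔA‖ < 1 is added: at norm 1 the right-hand side is undefined, and above 1 it is negative, so the stated inequality fails (e.g. X=ℂ, A=1, z=0, x=y=1, ΔA=2, δy=0). *)

(* Defs.v *)
From HB Require Import structures.
From mathcomp Require Import all_boot all_order all_algebra.
From mathcomp Require Import complex.
From mathcomp Require Import boolp classical_sets functions reals topology.
From mathcomp Require Import normedtype.

Set Implicit Arguments.
Unset Strict Implicit.
Unset Printing Implicit Defensive.

Import Order.TTheory GRing.Theory Num.Theory.
Import numFieldNormedType.Exports.

Local Open Scope ring_scope.
Local Open Scope complex_scope.
Local Open Scope classical_set_scope.

(* The norm of a normed module over R[i] takes its values in R[i]; these values
   are real and nonnegative, so that nothing is lost by taking the real part. *)
Definition rnorm (R : realType) (X : normedModType R[i]) (x : X) : R :=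
  complex.Re `|x|.

Section RealNorm.
Variables (R : realType) (X : normedModType R[i]).
Implicit Types x y : X.

Lemma rnormE x : (rnorm x)%:C = `|x|.
Proof. by rewrite /rnorm RRe_real ?normr_real. Qed.

Lemma rnorm_ge0 x : 0 <= rnorm x.
Proof. by rewrite -lecR rnormE normr_ge0. Qed.

Lemma rnormD x y : rnorm (x + y) <= rnorm x + rnorm y.
Proof. by rewrite -lecR rmorphD/= !rnormE ler_normD. Qed.

Lemma rnormZ (a : R[i]) x : rnorm (a *: x) = complex.Re `|a| * rnorm x.
Proof.
by rewrite {1}/rnorm normrZ -(rnormE x); case: `|a| => p q /=; rewrite mulr0 subr0.
Qed.

Lemma rnorm0 : rnorm (0 : X) = 0.
Proof. by rewrite /rnorm normr0. Qed.

End RealNorm.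

Definition bounded_linear (R : realType) (X : normedModType R[i]) :
    {pred X -> X} :=
  fun f => `[< linear f /\
    exists M : R, forall x : X, rnorm (f x) <= M * rnorm x >].
Arguments bounded_linear {R} X.

Record BL (R : realType) (X : normedModType R[i]) :=
  MkBL { BL_fun :> X -> X ; _ : BL_fun \in bounded_linear X }.

Section BLAlgebra.
Variables (R : realType) (X : normedModType R[i]).

Lemma bounded_linearP (f : X -> X) :
  reflect (linear f /\ exists M : R, forall x, rnorm (f x) <= M * rnorm x)
          (f \in bounded_linear X).
Proof. exact: asboolP. Qed.

Fact bounded_linear_submod_closed : submod_closed (bounded_linear X).
Proof.
split.
  apply/bounded_linearP; split=> [a x y|]; first by rewrite scaler0 addr0.
  by exists 0 => x; rewrite rnorm0 mul0r.
move=> a f g /bounded_linearP[lf [M fM]] /bounded_linearP[lg [N gN]].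
apply/bounded_linearP; split=> [b x y|].
  change (a *: f (b *: x + y) + g (b *: x + y) =
          b *: (a *: f x + g x) + (a *: f y + g y)).
  by rewrite lf lg !scalerDr !scalerA (mulrC a b) addrACA.
exists (complex.Re `|a| * M + N) => x.
change (rnorm (a *: f x + g x) <= (complex.Re `|a| * M + N) * rnorm x).
rewrite (le_trans (rnormD _ _))// mulrDl lerD// rnormZ -mulrA ler_wpM2l//.
by rewrite -lecR RRe_real ?normr_real ?normr_ge0.
Qed.

HB.instance Definition _ :=
  GRing.isSubmodClosed.Build R[i] (X -> X) (bounded_linear X)
    bounded_linear_submod_closed.

HB.instance Definition _ := [isSub for @BL_fun R X].
HB.instance Definition _ := [Choice of BL X by <:].
HB.instance Definition _ := [SubChoice_isSubLmodule of BL X by <:].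

Fact id_bounded_linear : (id : X -> X) \in bounded_linear X.
Proof.
by apply/bounded_linearP; split=> //; exists 1 => x; rewrite mul1r.
Qed.

Fact comp_bounded_linear (A B : BL X) : A \o B \in bounded_linear X.
Proof.
have /bounded_linearP[lA [M AM]] := valP A.
have /bounded_linearP[lB [N BN]] := valP B.
apply/bounded_linearP; split=> [a x y|].
  by change (A (B (a *: x + y)) = a *: A (B x) + A (B y)); rewrite lB lA.
exists (Num.max 0 M * N) => x /=; rewrite (le_trans (AM _))//.
rewrite (@le_trans _ _ (Num.max 0 M * rnorm (B x)))//.
  by apply: ler_wpM2r; [exact: rnorm_ge0 | rewrite le_max lexx orbT].
by rewrite -mulrA; apply: ler_wpM2l; [rewrite le_max lexx | exact: BN].
Qed.

Definition BL_one : BL X := MkBL id_bounded_linear.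
Definition BL_mul (A B : BL X) : BL X := MkBL (comp_bounded_linear A B).

Fact BL_mulA : associative BL_mul.
Proof. by move=> A B C; apply: val_inj. Qed.

Fact BL_mul1l : left_id BL_one BL_mul.
Proof. by move=> A; apply: val_inj. Qed.

Fact BL_mul1r : right_id BL_one BL_mul.
Proof. by move=> A; apply: val_inj. Qed.

Fact BL_mulDl : left_distributive BL_mul +%R.
Proof. by move=> A B C; apply: val_inj; rewrite !raddfD. Qed.

Fact BL_mulDr : right_distributive BL_mul +%R.
Proof.
move=> A B C; apply: val_inj; apply/funext => x.
have [lA _] : linear A /\ _ := elimT (bounded_linearP A) (valP A).
by have := lA 1 (B x) (C x); rewrite !scale1r.
Qed.

HB.instance Definition _ := GRing.Zmodule_isPzRing.Build (BL X)
  BL_mulA BL_mul1l BL_mul1r BL_mulDl BL_mulDr.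

End BLAlgebra.

Section ConditionSpectrum.
Variables (R : realType) (X : normedModType R[i]).
Implicit Types (A B : BL X) (z : R[i]) (e : R).

Definition opnorm A : R :=
  sup [set rnorm (A x) | x in [set x : X | rnorm x <= 1]].

Definition is_inverse A B : Prop := A * B = 1 /\ B * A = 1.

Definition invertible A : Prop := exists B, is_inverse A B.

(* The inverse in BL(X), with the junk value 0 when A is not invertible. *)
Definition opinv A : BL X := xget 0 [set B | is_inverse A B].

Definition spectrum A : set R[i] :=
  [set z : R[i] | ~ invertible (A - z *: (1 : BL X))].

Definition cond_pseudospectrum e A : set R[i] :=
  spectrum A `|`
  [set z : R[i] | e^-1 <=
     opnorm (A - z *: (1 : BL X)) * opnorm (opinv (A - z *: (1 : BL X)))].

Definition kappa z A : R :=
  sup [set e : R | 0 < e < 1 /\ ~ cond_pseudospectrum e A z].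

End ConditionSpectrum.

(* Main.v *)
(* With T = A - zI, S = T^-1 and D = dA, subtracting T x = y from the perturbed
   equation gives dx = S (dy - D x) - S D dx, whence
   (1 - |S D|) |dx| <= |S| (|dy| + |D| |x|); dividing by |x| and using
   |y| <= |T| |x| makes the factor |T| |S| appear, and |T| |S| <= 1 / kappa
   because every e in the set defining kappa satisfies e < 1 / (|T| |S|). *)
Require Import Defs.
From HB Require Import structures.
From mathcomp Require Import all_boot all_order all_algebra.
From mathcomp Require Import complex.
From mathcomp Require Import boolp classical_sets functions reals topology.
From mathcomp Require Import normedtype.

Set Implicit Arguments.
Unset Strict Implicit.
Unset Printing Implicit Defensive.

Import Order.TTheory GRing.Theory Num.Theory.
Import numFieldNormedType.Exports.

Local Open Scope ring_scope.
Local Open Scope complex_scope.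
Local Open Scope classical_set_scope.

Section OperatorNorm.
Variables (R : realType) (X : normedModType R[i]).
Implicit Types (A B : BL X) (x y : X).

Lemma BL_linear A : linear A.
Proof. by have /bounded_linearP[] := valP A. Qed.

Lemma BL_apply0 A : A 0 = 0.
Proof. by have := BL_linear A (-1) 0 0; rewrite scaler0 addr0 scaleN1r addNr. Qed.

Lemma BL_applyD A x y : A (x + y) = A x + A y.
Proof. by have := BL_linear A 1 x y; rewrite !scale1r. Qed.

Lemma BL_applyZ A (a : R[i]) x : A (a *: x) = a *: A x.
Proof. by have := BL_linear A a x 0; rewrite !addr0 BL_apply0 addr0. Qed.

Lemma rnorm_eq0 x : (rnorm x == 0) = (x == 0).
Proof. by rewrite -(inj_eq (@complexI R)) rnormE normr_eq0. Qed.

Lemma rnormN x : rnorm (- x) = rnorm x.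
Proof. by rewrite /rnorm normrN. Qed.

Lemma rnormZr (r : R) x : 0 <= r -> rnorm (r%:C *: x) = r * rnorm x.
Proof. by move=> r0; rewrite rnormZ ger0_norm ?ler0c. Qed.

Lemma opnorm_ub A x : rnorm x <= 1 -> rnorm (A x) <= opnorm A.
Proof.
move=> x1; apply: ub_le_sup; last by exists x.
have /bounded_linearP[_ [M AM]] := valP A.
(* The bound [M] may be negative on the zero space; replacing it by [Num.max 0 M] makes the product
   with [rnorm v <= 1] at most [Num.max 0 M]. *)
exists (Num.max 0 M) => _ [v /= v1 <-].
rewrite (le_trans (AM v))// (@le_trans _ _ (Num.max 0 M * rnorm v))//.
  by rewrite ler_wpM2r ?rnorm_ge0// le_max lexx orbT.
by rewrite ler_piMr// le_max lexx.
Qed.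

Lemma opnorm_ge0 A : 0 <= opnorm A.
Proof. by rewrite (le_trans (rnorm_ge0 (A 0)))// opnorm_ub// rnorm0 ler01. Qed.

(** For nonzero [x], the bound on the unit ball is applied to [x] rescaled to norm 1. *)
Lemma rnorm_apply_le A x : rnorm (A x) <= opnorm A * rnorm x.
Proof.
have [->|x0] := eqVneq x 0; first by rewrite BL_apply0 rnorm0 mulr0.
have r0 : 0 < rnorm x by rewrite lt_neqAle eq_sym rnorm_eq0 x0 rnorm_ge0.
have := @opnorm_ub A ((rnorm x)^-1%:C *: x).
rewrite BL_applyZ !rnormZr ?invr_ge0 ?(ltW r0)// mulVf ?gt_eqF// => /(_ (lexx _)).
by rewrite mulrC ler_pdivrMr.
Qed.

Lemma opinvP A : invertible A -> is_inverse A (opinv A).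
Proof. by move=> [B AB]; apply: (@xgetPex _ 0 [set B | is_inverse A B]); exists B. Qed.

Lemma opinvK A x : invertible A -> opinv A (A x) = x.
Proof. by move=> /opinvP[_ /(congr1 (fun B : BL X => B x))]. Qed.

End OperatorNorm.

Section ConditionNumber.
Variables (R : realType) (X : normedModType R[i]).
Implicit Types (A : BL X) (z : R[i]).

Let cond A z := opnorm (A - z *: (1 : BL X)) * opnorm (opinv (A - z *: (1 : BL X))).

(** A real [sup] is [0] by default on an empty or unbounded set, so positivity needs an explicit
    positive member together with the upper bound [1]. It allows multiplying inequalities by
    [kappa z A]. *)
Lemma kappa_gt0 A z : ~ spectrum A z -> 0 < kappa z A.
Proof.
move=> zA.
have c0 : 0 <= cond A z by rewrite mulr_ge0 ?opnorm_ge0.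
have c2 : 0 < cond A z + 2 by rewrite ltr_wpDl.
(* The summand [2] puts this witness strictly below [1] even when [cond A z = 0], and its inverse
   exceeds [cond A z]. *)
apply: (@lt_le_trans _ _ (cond A z + 2)^-1); first by rewrite invr_gt0.
apply: ub_le_sup; first by exists 1 => e [/andP[_ /ltW]].
split; first by rewrite invr_gt0 c2 invf_lt1// ltr_wpDl// ltr1n.
by case=> // /=; rewrite invrK leNgt ltrDl ltr0n.
Qed.

Lemma kappa_cond_le1 A z : ~ spectrum A z -> kappa z A * cond A z <= 1.
Proof.
move=> zA; have c0 : 0 <= cond A z by rewrite mulr_ge0 ?opnorm_ge0.
(* The condition number vanishes on the zero space, so this case is split off before dividing by
   it. *)
have [<-|cn0] := eqVneq 0 (cond A z); first by rewrite mulr0 ler01.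
have cp : 0 < cond A z by rewrite lt_neqAle cn0.
rewrite -ler_pdivlMr// div1r /kappa.
have [->|/set0P S0] := eqVneq [set e : R | 0 < e < 1 /\ ~ cond_pseudospectrum e A z] set0.
  by rewrite sup0 invr_ge0.
apply: ge_sup => // e [/andP[e0 _] ze].
rewrite -[e]invrK lef_pV2 ?posrE ?invr_gt0// leNgt; apply/negP => /ltW ce.
by apply: ze; right.
Qed.

End ConditionNumber.

Theorem theorem3p7 (R : realType) (X : completeNormedModType R[i])
    (A dA : BL X) (x y dx dy : X) (z : R[i]) :
  ~ spectrum A z ->
  A x - z *: x = y ->
  (A - z *: (1 : BL X) + dA) (x + dx) = y + dy ->
  opnorm (opinv (A - z *: (1 : BL X)) * dA) < 1 ->
  rnorm dx / rnorm x <=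
    1 / (kappa z A * (1 - opnorm (opinv (A - z *: (1 : BL X)) * dA))) *
    (rnorm dy / rnorm y + opnorm dA / opnorm (A - z *: (1 : BL X))).
Proof.
move=> zA Axy; set T := A - z *: (1 : BL X) => Tdx.
set S := opinv T; set q := opnorm (S * dA) => q1.
have Tinv : invertible T by apply: contrapT.
have Txy : T x = y by [].
have k0 := kappa_gt0 zA.
have q0 : 0 < 1 - q by rewrite subr_gt0.
have sum0 : 0 <= rnorm dy / rnorm y + opnorm dA / opnorm T.
  by rewrite addr_ge0// divr_ge0 ?rnorm_ge0 ?opnorm_ge0.
(* For [x = 0] the left-hand side is [0] since [0^-1 = 0]. *)
have [x0|xn0] := eqVneq x 0.
  by rewrite {1}x0 rnorm0 invr0 mulr0 mulr_ge0// divr_ge0// ltW// mulr_gt0.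
have yn0 : y != 0.
  by apply: contra_neq xn0 => y0; rewrite -(opinvK x Tinv) Txy y0 BL_apply0.
have px : 0 < rnorm x by rewrite lt_neqAle eq_sym rnorm_eq0 xn0 rnorm_ge0.
have py : 0 < rnorm y by rewrite lt_neqAle eq_sym rnorm_eq0 yn0 rnorm_ge0.
have yx : rnorm y <= opnorm T * rnorm x by rewrite -Txy rnorm_apply_le.
(* From [0 < rnorm y <= opnorm T * rnorm x]; positivity lets [opnorm T] cancel in
   [opnorm dA / opnorm T]. *)
have pT : 0 < opnorm T by rewrite -(pmulr_lgt0 _ px) (lt_le_trans py).
have Tdx' : T dx = dy - dA x - dA dx.
  have : (T x + T dx) + (dA x + dA dx) = y + dy by rewrite -!BL_applyD.
  by rewrite Txy -addrA => /addrI <-; rewrite -addrA -opprD addrK.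
have dxE : dx = S (dy - dA x) - (S * dA) dx.
  rewrite -[LHS](opinvK _ Tinv) Tdx' BL_applyD; congr (_ + _).
  by rewrite -scaleN1r BL_applyZ scaleN1r.
have dx_le : rnorm dx * (1 - q) <= opnorm S * (rnorm dy + opnorm dA * rnorm x).
  rewrite mulrBr mulr1 lerBlDr {1}dxE (le_trans (rnormD _ _))// rnormN.
  rewrite lerD//; last by rewrite mulrC rnorm_apply_le.
  rewrite (le_trans (rnorm_apply_le _ _))// ler_wpM2l ?opnorm_ge0//.
  by rewrite (le_trans (rnormD _ _))// rnormN lerD2l rnorm_apply_le.
(* The [dA] terms on the two sides agree, and the [dy] terms compare by
   [1 / rnorm x <= opnorm T / rnorm y], which is [yx]. *)
have xy_le : (rnorm dy + opnorm dA * rnorm x) / rnorm x <=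
    opnorm T * (rnorm dy / rnorm y + opnorm dA / opnorm T).
  rewrite mulrDl mulfK ?gt_eqF// mulrDr (mulrCA _ (opnorm dA)) divff ?gt_eqF//.
  rewrite mulr1 lerD2r mulrCA ler_wpM2l ?rnorm_ge0//.
  by rewrite ler_pdivlMr// mulrC ler_pdivrMr.
rewrite div1r [leRHS]mulrC ler_pdivlMr ?mulr_gt0//.
rewrite mulrCA mulrAC.
(* With the denominators cleared, [dx_le] and [xy_le] bound the left-hand side by this middle term,
   whose factor [kappa z A * (opnorm T * opnorm S)] is at most [1]. *)
apply: (@le_trans _ _ (kappa z A * (opnorm T * opnorm S) *
    (rnorm dy / rnorm y + opnorm dA / opnorm T))); last first.
  by rewrite ler_piMl// kappa_cond_le1.
rewrite -!mulrA ler_wpM2l ?(ltW k0)// mulrA [leRHS]mulrCA.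
rewrite (le_trans (ler_wpM2r _ dx_le)) ?invr_ge0 ?rnorm_ge0//.
by rewrite -mulrA ler_wpM2l ?opnorm_ge0.
Qed.
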